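(* Let $n\ge2$ and let $\Delta$ be the $1$-dimensional simplicial complex of a simple graph $G$ on $[n]$. Then: (1) an edge $\{u,v\}$ of $G$ is exposed (as a facet of $\Delta$) if and only if $u$ or $v$ is a leaf; (2) $\Delta$ is fully exposed if and only if $G$ is a disjoint union of stars with no isolated vertex; (3) $\Delta$ is fully hidden if and only if $G$ has no vertex of degree exactly $1$.
   Context: $[n]=\{1,\dots,n\}$. The simplicial complex $\Delta$ of a simple graph $G$ on $[n]$ has as faces $\emptyset$, all singletons $\{i\}$, and all edges of $G$; its facets (inclusion-maximal faces) are the edges together with the isolated vertices (as singletons). A leaf is a vertex of degree one. A star is a graph in which one vertex is adjacent to all the others and no other edges are present. For a face $S$, $\operatorname{cl}(S)$ is the intersection of all facets containing $S$. For $i\in[n]$, $\mathcal A_i(\Delta)=\{S\subseteq[n]\setminus\{i\}: S\in\Delta,\ i\in\operatorname{cl}(S)\}$. A facet $F$ is exposed if there exist $i\in[n]$ and $S\in\mathcal A_i(\Delta)$ with $S\subseteq F$, and hidden otherwise. $\Delta$ is fully exposed if every facet is exposed and fully hidden if every facet is hidden. *)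

(* Defs.v *)
From mathcomp Require Import all_boot.
Set Implicit Arguments. Unset Strict Implicit. Unset Printing Implicit Defensive.

Section Complex.
Variable T : finType.
Implicit Types (D : {set {set T}}) (S F : {set T}) (i : T).

Definition facets D : {set {set T}} := [set F | maxset (mem D) F].

(* The empty intersection is the whole of T, but every face of a finite complex
   lies in some facet, so this convention is never used on faces. *)
Definition cl D S : {set T} := \bigcap_(F in facets D | S \subset F) F.

Definition calA D i : {set {set T}} :=
  [set S in D | (i \notin S) && (i \in cl D S)].

Definition exposed D F : bool :=
  (F \in facets D) && [exists i, exists S in calA D i, S \subset F].

Definition hidden D F : bool := (F \in facets D) && ~~ exposed D F.

Definition fully_exposed D : Prop := forall F, F \in facets D -> exposed D F.

Definition fully_hidden D : Prop := forall F, F \in facets D -> hidden D F.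

End Complex.

Section Graph.
Variables (T : finType) (e : rel T).

Definition graph_complex : {set {set T}} :=
  [set S | [|| S == set0, [exists x, S == [set x]]
             | [exists x, exists y, e x y && (S == [set x; y])]]].

Definition degree (x : T) : nat := #|[set y | e x y]|.

Definition leaf (x : T) : bool := degree x == 1.

Definition isolated (x : T) : bool := degree x == 0.

(* The subgraph induced on B is a star; a single vertex counts as a star. *)
Definition is_star (B : {set T}) : Prop :=
  exists c, [/\ c \in B,
    forall x, x \in B -> x != c -> e c x &
    forall x y, x \in B -> y \in B -> e x y -> x = c \/ y = c].

Definition disjoint_union_of_stars : Prop :=
  exists P : {set {set T}},
    [/\ partition P [set: T],
        forall B, B \in P -> is_star B &
        forall x y, e x y -> pblock P x = pblock P y].

End Graph.

(* Main.v *)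
Require Import Defs.
From mathcomp Require Import all_boot.
Set Implicit Arguments. Unset Strict Implicit. Unset Printing Implicit Defensive.

(** Suppose [S] witnesses that the facet [F] is exposed through [i].  As [F] is
    one of the facets intersected in [cl S], [i] lies in [F]; and closure is
    monotone, so the largest possible witness [F :\ i] works as well.  Hence a
    facet is exposed exactly when it contains a vertex [i] lying in the closure
    of [F :\ i] ([exposedP]).

    For an edge [{u, v}] this reads: every facet through [u] contains [v], or
    the converse.  The facets through [u] being the edges at [u], the first
    condition says that [u] has no neighbour but [v] ([cl_vertex]); this gives
    part (1).  For an isolated vertex [x] it reads: every facet contains [x],
    which fails as soon as there is another vertex ([isolated_not_exposed]).

    So the exposed facets are the edges with a leaf endpoint, and (3) follows.
    Moreover the complex is fully exposed iff there is no isolated vertex and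
    every edge has a leaf endpoint.  The latter condition characterises
    disjoint unions of stars: in such a graph the closed neighbourhoods of the
    vertices all of whose neighbours are leaves are stars which partition the
    vertices and contain all the edges ([starsP]). *)

(** * Closure and exposed facets *)

Section Exposed.
Variables (T : finType) (D : {set {set T}}).
Implicit Types (S F : {set T}) (i : T).

Lemma clP S i :
  reflect (forall F, F \in facets D -> S \subset F -> i \in F) (i \in cl D S).
Proof.
apply: (iffP bigcapP) => [h F FD SF | h F /andP[FD SF]]; last exact: h.
by apply: h; rewrite FD SF.
Qed.

Lemma facet_above S : S \in D -> exists2 F, F \in facets D & S \subset F.
Proof.
by move=> SD; have [F Fmax SF] := maxset_exists SD; exists F; rewrite ?inE.
Qed.

(** Among the witnesses exposing [F] through [i], [F :\ i] is the largest, and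
    closure is monotone. *)
Lemma exposedP F :
    F \in facets D -> (forall i, i \in F -> F :\ i \in D) ->
  reflect (exists2 i, i \in F & i \in cl D (F :\ i)) (exposed D F).
Proof.
move=> FD Fdown; rewrite /exposed FD.
apply: (iffP existsP) => [[i /existsP[S /andP[]]] | [i iF icl]].
  rewrite inE => /and3P[_ iS /clP icl] SF; exists i; first exact: icl.
  apply/clP => G GD FG; apply: icl => //.
  by apply: subset_trans FG; rewrite subsetD1 SF.
exists i; apply/existsP; exists (F :\ i).
by rewrite inE Fdown // setD11 icl subD1set.
Qed.

End Exposed.

(** * The complex of a graph *)

Section GraphComplex.
Variables (T : finType) (e : rel T).
Hypotheses (e_sym : symmetric e) (e_irr : irreflexive e).
Implicit Types (S F : {set T}) (u v w x y z : T).

Let D := graph_complex e.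

Lemma edge_neq x y : e x y -> x != y.
Proof. by apply: contraTneq => ->; rewrite e_irr. Qed.

Lemma set0_face : set0 \in D.
Proof. by rewrite inE eqxx. Qed.

Lemma vertex_face x : [set x] \in D.
Proof.
by rewrite inE; apply/or3P; apply: Or32; apply/existsP; exists x.
Qed.

Lemma edge_face x y : e x y -> [set x; y] \in D.
Proof.
move=> exy; rewrite inE; apply/or3P; apply: Or33.
by apply/existsP; exists x; apply/existsP; exists y; rewrite exy eqxx.
Qed.

Variant face_spec S : Prop :=
  | EmptyFace of S = set0
  | VertexFace x of S = [set x]
  | EdgeFace x y of e x y & S = [set x; y].

Lemma faceP S : S \in D -> face_spec S.
Proof.
rewrite inE => /or3P[/eqP | /existsP[x /eqP] |].
- exact: EmptyFace.
- exact: VertexFace.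
- by move=> /existsP[x /existsP[y /andP[exy /eqP]]]; exact: EdgeFace.
Qed.

Lemma edge_facet x y : e x y -> [set x; y] \in facets D.
Proof.
move=> exy; rewrite inE; apply/maxsetP; split; first exact: edge_face.
move=> S SD sub; apply/esym/eqP; rewrite eqEcard sub cards2 edge_neq //.
case: (faceP SD) => [-> | z -> | z t _ ->]; rewrite ?cards0 ?cards1 //.
by rewrite cards2; case: (z != t).
Qed.

Lemma isolatedPn x : reflect (exists y, e x y) (~~ isolated e x).
Proof.
rewrite /isolated /degree cards_eq0.
by apply: (iffP (set0Pn _)) => -[y]; rewrite ?inE; exists y; rewrite ?inE.
Qed.

Lemma isolated_facet x : isolated e x -> [set x] \in facets D.
Proof.
move=> ix; rewrite inE; apply/maxsetP; split; first exact: vertex_face.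
move=> S /faceP[->|y ->|y z eyz ->]; rewrite sub1set.
- by rewrite inE.
- by rewrite inE => /eqP->.
case/set2P=> xE; case/isolatedPn: ix; rewrite xE; first by exists z.
by exists y; rewrite e_sym.
Qed.

Variant facet_spec F : Prop :=
  | IsolatedFacet x of isolated e x & F = [set x]
  | EdgeFacet x y of e x y & F = [set x; y].

(** The default vertex [x0] excludes the complex [{set0}], whose only facet is
    empty. *)
Lemma facetP (x0 : T) F : F \in facets D -> facet_spec F.
Proof.
rewrite inE => /maxsetP[/faceP[F0 | x Fx | x y exy ->] Fmax]; last exact: EdgeFacet exy _.
  have := Fmax _ (vertex_face x0); rewrite F0 sub0set => /(_ isT) /setP/(_ x0).
  by rewrite !inE eqxx.
apply: (IsolatedFacet _ Fx); apply: contraT => /isolatedPn[y exy].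
have := Fmax _ (edge_face exy); rewrite Fx sub1set !inE eqxx => /(_ isT) /setP/(_ y).
by rewrite !inE eqxx orbT eq_sym (negPf (edge_neq exy)).
Qed.

Lemma leafP u v : e u v -> reflect (forall w, e u w -> w = v) (leaf e u).
Proof.
move=> euv; apply: (iffP cards1P) => [[z Nu] w euw | uniq_v].
  have in_z t : e u t -> t = z.
    by move=> eut; apply/set1P; rewrite -Nu inE.
  by rewrite (in_z w euw) (in_z v euv).
exists v; apply/setP=> w; rewrite !inE.
by apply/idP/eqP => [/uniq_v | ->].
Qed.

(** The facets through the non-isolated vertex [u] are the edges at [u], so
    their intersection contains [v] only if there is no edge but [{u, v}]. *)
Lemma cl_vertex u v : e u v -> (v \in cl D [set u]) = leaf e u.
Proof.
move=> euv; apply/clP/(leafP euv) => [h w euw | u_leaf F /(facetP u)].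
  have := h _ (edge_facet euw); rewrite sub1set !inE eqxx => /(_ isT).
  by rewrite eq_sym (negPf (edge_neq euv)) => /eqP.
case=> [x ix -> | x y exy ->]; rewrite sub1set !inE.
  by move=> /eqP ux; case/isolatedPn: ix; exists v; rewrite -ux.
case/pred2P=> uE; rewrite -uE in exy.
  by rewrite (u_leaf _ exy) eqxx orbT.
by rewrite (u_leaf x) ?eqxx // e_sym.
Qed.

Lemma exposed_edge u v : e u v -> exposed D [set u; v] = leaf e u || leaf e v.
Proof.
move=> euv; have evu : e v u by rewrite e_sym.
have uv := edge_neq euv.
have Du : [set u; v] :\ u = [set v] by rewrite setU1K // inE.
have Dv : [set u; v] :\ v = [set u] by rewrite setUC setU1K // inE eq_sym.
have down i : i \in [set u; v] -> [set u; v] :\ i \in D.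
  by case/set2P=> ->; rewrite ?Du ?Dv vertex_face.
apply/(exposedP (edge_facet euv) down)/orP => [[i] | []].
- by case/set2P=> ->; rewrite ?Du ?Dv cl_vertex //; [right | left].
- by exists v; rewrite ?set22 // Dv cl_vertex.
- by exists u; rewrite ?set21 // Du cl_vertex.
Qed.

(** Exposing [{x}] would require [x] to lie in every facet, but a facet through
    another vertex misses the isolated vertex [x]. *)
Lemma isolated_not_exposed x :
  1 < #|T| -> isolated e x -> ~~ exposed D [set x].
Proof.
move=> T_gt1 ix; have Dx : [set x] :\ x = set0 by rewrite setDv.
have down i : i \in [set x] -> [set x] :\ i \in D.
  by move=> /set1P->; rewrite Dx set0_face.
apply/(exposedP (isolated_facet ix) down) => -[i /set1P->].
rewrite Dx => /clP xall.
have [y yx] : exists y, y != x.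
  have : 0 < #|[set~ x]| by rewrite cardsC1 -ltnS prednK // ltnW.
  by case/card_gt0P=> y; rewrite !inE; exists y.
have [F FD] := facet_above (vertex_face y).
have := xall F FD (sub0set F); rewrite sub1set.
case: (facetP x FD) => [z _ -> /set1P xz /set1P yz | z t ezt ->].
  by rewrite xz yz eqxx in yx.
by case/set2P=> xE; case/isolatedPn: ix; rewrite xE; [exists t | exists z; rewrite e_sym].
Qed.

(** * Disjoint unions of stars *)

Definition closed_nbhd x : {set T} := [set y | (y == x) || e x y].

(** With this choice no representative has to be picked in an isolated edge,
    both of whose endpoints are centres, and an isolated vertex is the centre
    of a one-vertex star. *)
Definition star_center x : bool := [forall y, e x y ==> leaf e y].

Lemma star_centerP x :
  reflect (forall y, e x y -> leaf e y) (star_center x).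
Proof. exact: 'forall_implyP. Qed.

Lemma closed_nbhdC x y : (y \in closed_nbhd x) = (x \in closed_nbhd y).
Proof. by rewrite !inE eq_sym e_sym. Qed.

(** The neighbours of a star centre [c] are leaves, hence adjacent to [c] only:
    the closed neighbourhood of [c] is a connected component. *)
Lemma closed_nbhd_stable c x :
  star_center c -> x \in closed_nbhd c -> closed_nbhd x \subset closed_nbhd c.
Proof.
move=> /star_centerP c_leaves; rewrite inE => /predU1P[-> // | ecx].
have exc : e x c by rewrite e_sym.
apply/subsetP=> y; rewrite [_ \in closed_nbhd x]inE => /predU1P[-> | exy].
  by rewrite inE ecx orbT.
by rewrite (leafP exc (c_leaves _ ecx) _ exy) inE eqxx.
Qed.

Lemma closed_nbhd_star c : star_center c -> is_star e (closed_nbhd c).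
Proof.
move=> /star_centerP c_leaves; exists c; split; first by rewrite inE eqxx.
  by move=> x; rewrite inE => /predU1P[-> /eqP | ].
move=> x y; rewrite inE => /predU1P[-> | ecx] _ exy; first by left.
have exc : e x c by rewrite e_sym.
by right; exact: leafP exc (c_leaves _ ecx) _ exy.
Qed.

Lemma closed_nbhd_eq c d x :
    star_center c -> star_center d ->
  x \in closed_nbhd c -> x \in closed_nbhd d -> closed_nbhd c = closed_nbhd d.
Proof.
suff sub a b : star_center a -> star_center b -> x \in closed_nbhd a ->
    x \in closed_nbhd b -> closed_nbhd a \subset closed_nbhd b.
  by move=> *; apply/eqP; rewrite eqEsubset !sub.
move=> _ b_center xa xb; apply: closed_nbhd_stable => //.
by apply: subsetP (closed_nbhd_stable b_center xb) _ _; rewrite -closed_nbhdC.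
Qed.

(** If every edge has a leaf endpoint, then the neighbour of a leaf is a star
    centre: an edge joining it to a non-leaf would make it a leaf itself, with
    the original leaf as its only neighbour.  So each edge lies in the closed
    neighbourhood of a centre, and these neighbourhoods, being components, are
    the blocks of the partition. *)
Lemma starsP :
  disjoint_union_of_stars e <-> (forall x y, e x y -> leaf e x || leaf e y).
Proof.
split=> [[P [partP stars edge_in]] x y exy | edge_leaf].
  have [/eqP coverP trivP _] := and3P partP.
  have inP z : z \in cover P by rewrite coverP inE.
  have self z : z \in pblock P z by rewrite mem_pblock.
  have [c [_ _ adj_c]] := stars _ (pblock_mem (inP x)).
  have xB : x \in pblock P x by [].
  have yB : y \in pblock P x by rewrite (edge_in _ _ exy).
  (* All neighbours of [b] lie in the block of [x], and an edge of that star
     at the non-central vertex [b] must end at the centre. *)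
  have leaf_end a b : e a b -> a \in pblock P x -> b \in pblock P x -> a = c ->
      leaf e b.
    move=> eab aB bB ac; have eba : e b a by rewrite e_sym.
    apply/(leafP eba) => w ebw.
    have wB : w \in pblock P x.
      by rewrite -(same_pblock trivP bB) (edge_in _ _ ebw).
    have [bc | -> //] := adj_c _ _ bB wB ebw.
    by have := edge_neq eab; rewrite ac bc eqxx.
  case: (adj_c _ _ xB yB exy) => [xc | yc]; apply/orP; [right | left].
    exact: leaf_end exy xB yB xc.
  by apply: leaf_end yB xB yc; rewrite e_sym.
have center x y : e x y -> leaf e y -> star_center x.
  move=> exy yleaf; apply/star_centerP=> z exz.
  by have /orP[/(leafP exy)/(_ z exz)-> | ] := edge_leaf _ _ exz.
have edge_center x y : e x y ->
    exists c, [/\ star_center c, x \in closed_nbhd c & y \in closed_nbhd c].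
  move=> exy; have eyx : e y x by rewrite e_sym.
  have [xl | yl] := orP (edge_leaf _ _ exy).
    by exists y; rewrite !inE eqxx eyx orbT (center _ _ eyx xl).
  by exists x; rewrite !inE eqxx exy orbT (center _ _ exy yl).
have vertex_center x : exists2 c, star_center c & x \in closed_nbhd c.
  have [ix | /isolatedPn[y exy]] := boolP (isolated e x).
    exists x; last by rewrite inE eqxx.
    apply/star_centerP=> y exy.
    by case/isolatedPn: ix; exists y.
  by have [c [cC xc _]] := edge_center _ _ exy; exists c.
pose P := [set closed_nbhd c | c in star_center].
have trivP : trivIset P.
  apply/trivIsetP=> _ _ /imsetP[c cC ->] /imsetP[d dC ->].
  apply: contraNT => /pred0Pn[x /andP[xc xd]].
  by apply/eqP; exact: closed_nbhd_eq cC dC xc xd.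
exists P; split.
- apply/and3P; split=> //.
    apply/eqP/setP=> x; rewrite inE; apply/bigcupP.
    by have [c cC xc] := vertex_center x; exists (closed_nbhd c); rewrite ?imset_f.
  by apply/imsetP=> -[c _ /setP/(_ c)]; rewrite !inE eqxx.
- by move=> _ /imsetP[c cC ->]; exact: closed_nbhd_star.
move=> x y exy; have [c [cC xc yc]] := edge_center _ _ exy.
have cP : closed_nbhd c \in P by apply: imset_f.
by rewrite (def_pblock trivP cP xc) (def_pblock trivP cP yc).
Qed.

(** * Fully exposed and fully hidden complexes *)

Lemma fully_exposedP :
    1 < #|T| ->
  fully_exposed D <->
    disjoint_union_of_stars e /\ (forall x, ~~ isolated e x).
Proof.
move=> T_gt1; split=> [exp | [/starsP edge_leaf noniso] F FD].
  split; first by apply/starsP=> x y exy; rewrite -exposed_edge // exp ?edge_facet.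
  move=> x; apply/negP=> ix; have := exp _ (isolated_facet ix).
  by apply/negP; exact: isolated_not_exposed.
have [x0 _] : exists x, x \in T by apply/card_gt0P; exact: ltnW.
case: (facetP x0 FD) => [x ix _ | x y exy ->]; first by case/negP: (noniso x).
by rewrite exposed_edge // edge_leaf.
Qed.

Lemma fully_hiddenP :
  1 < #|T| -> fully_hidden D <-> ~ (exists x, degree e x = 1).
Proof.
move=> T_gt1; split=> [hid [x /eqP xleaf] | noleaf F FD].
  have [y exy] : exists y, e x y.
    by apply/isolatedPn; rewrite /isolated (eqP xleaf).
  have /andP[_ ] := hid _ (edge_facet exy).
  by rewrite exposed_edge // [leaf e x]xleaf.
have nleaf x : leaf e x = false by apply/eqP => xleaf; case: noleaf; exists x.
have [x0 _] : exists x, x \in T by apply/card_gt0P; exact: ltnW.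
rewrite /hidden FD; case: (facetP x0 FD) => [x ix -> | x y exy ->].
  exact: isolated_not_exposed.
by rewrite exposed_edge // !nleaf.
Qed.

End GraphComplex.

Theorem proposition2p19 (n : nat) (hn : 2 <= n) (e : rel 'I_n)
    (e_sym : symmetric e) (e_irr : irreflexive e) :
  [/\ forall u v : 'I_n, e u v ->
        (exposed (graph_complex e) [set u; v] <-> leaf e u \/ leaf e v),
      fully_exposed (graph_complex e) <->
        disjoint_union_of_stars e /\ (forall x : 'I_n, ~~ isolated e x) &
      fully_hidden (graph_complex e) <->
        ~ (exists x : 'I_n, degree e x = 1)].
Proof.
have T_gt1 : 1 < #|'I_n| by rewrite card_ord.
split; [|exact: fully_exposedP | exact: fully_hiddenP].
by move=> u v euv; rewrite exposed_edge //; split=> /orP.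
Qed.
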